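(* Suppose that $G\in\mathcal{P}$, and consider the conditions (G1)–(G4) on $G$ listed in the context. (i) Suppose that $G$ satisfies either (G1) or (G2), and that the Borel measure $\mu$ has no atoms on $(0,1)$. Then $$\mathrm{GDS}_{\mathrm d}(x,y;G,\mu)=\int_{G(y)}^{G(x)}(\mathbf{1}\{x>y\}-\alpha)\,\mathrm{d}\mu(\alpha)\qquad\text{for all }x,y\in I.$$ In particular, the score depends only on the (oriented) interval from $G(y)$ to $G(x)$ in probability space. (ii) If $G$ satisfies either (G1) or (G2), then the scoring function $S_1:I\times I\to[0,1]$ given by $$S_1(x,y)=(\mathbf{1}\{x>y\}-G(y))^2-(\mathbf{1}\{x>y\}-G(x))^2$$ is equal to $\mathrm{GDS}_{\mathrm d}(\cdot,\cdot\,;G,\mu)$ when $\mathrm{d}\mu(\alpha)=2\,\mathrm{d}\alpha$, is equitable with respect to $G$, and is equivalent to $\mathrm{LEPS}_{\mathrm r}$. Its equitability constant is $1/3$ if $G$ satisfies (G1) and $1/3-G(0)^2+2G(0)^3/3$ if $G$ satisfies (G2). (iii) If $G$ satisfies either (G3) or (G4), then the scoring function $S_2:I\times I\to[0,\infty)$ defined by $$S_2(x,y)=\ln\left|\frac{\mathbf{1}\{x<y\}-G(x)}{\mathbf{1}\{x<y\}-G(y)}\right|,\qquad x,y\in I,$$ is equal to $\mathrm{GDS}_{\mathrm d}(\cdot,\cdot\,;G,\mu)$ when $\mathrm{d}\mu(\alpha)=(\alpha(1-\alpha))^{-1}\,\mathrm{d}\alpha$, is equitable with respect to $G$, and is equivalent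 to $\mathrm{GRIN}$. The equitability constant for $S_2$ is $1$ under (G3) and $1-G(0)$ under (G4). (iv) Suppose that $u:(0,1)\to\mathbb{R}$ is bounded, nonnegative and measurable. Define $U(z)=\int_0^z u(\alpha)\,\mathrm{d}\alpha$ and $V(z)=\int_0^z\alpha u(\alpha)\,\mathrm{d}\alpha$ for $0\le z\le1$. If $G$ satisfies either (G1) or (G2), then the scoring function $S_3:I\times I\to[0,\infty)$ defined by $$S_3(x,y;u)=\mathbf{1}\{x>y\}(U(G(x))-U(G(y)))-V(G(x))+V(G(y)),\qquad x,y\in I,$$ is equal to $\mathrm{GDS}_{\mathrm d}(\cdot,\cdot\,;G,\mu)$ when $\mathrm{d}\mu(\alpha)=u(\alpha)\,\mathrm{d}\alpha$ and is equitable with respect to $G$. The equitability constant for $S_3$ is $\int_b^1\alpha(1-\alpha)u(\alpha)\,\mathrm{d}\alpha$, where $b=0$ under (G1) and $b=G(0)$ under (G2).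
   Context: Let $I\subseteq\mathbb{R}$ be an interval. $\mathcal{P}$ is the class of Borel probability measures on $\mathbb{R}$ with mass concentrated in $I$; each $G\in\mathcal{P}$ is identified with its right-continuous CDF, and $G(z^-)$ denotes the left-hand limit. $\mu$ is a Borel measure on $(0,1)$, not necessarily a probability measure; it has no atoms if points have measure zero, so that inclusion or exclusion of endpoints of an interval of integration does not matter. $\mathbf{1}$ denotes the indicator function. Integrals $\int_a^b$ with $a>b$ mean $-\int_b^a$. $\mathcal{D}(G)=\{z\in\mathbb{R}:0<G(z)<1\}$; $\mathcal{R}(G)=\{\alpha\in(0,1):G(z)=\alpha\text{ for some }z\in\mathbb{R}\}$; $G^{-1}(\alpha)=\min\{z\in\mathbb{R}:G(z)\ge\alpha\}$ for $\alpha\in(0,1)$. Conditions: (G1) $G$ is continuous on $\mathbb{R}$ and strictly increasing on $\mathcal{D}(G)$. (G2) $I=[0,\infty)$, $G(0^-)=0<G(0)$, $G$ is continuous on $(0,\infty)$ and strictly increasing on $\mathcal{D}(G)$. (G3) $G$ satisfies (G1) and $0<G(z)<1$ for all $z\in\mathbb{R}$. (G4) $G$ satisfies (G2) and $G(z)<1$ for all $z\in\mathbb{R}$. For $x,y\in I$, $$\mathrm{GDS}_{\mathrm d}(x,y;G,\mu)=\int_{\mathcal{R}(G)}(\mathbf{1}\{y<x\}-\alpha)(\mathbf{1}\{G^{-1}(\alpha)<x\}-\mathbf{1}\{G^{-1}(\alpha)<y\})\,\mathrm{d}\mu(\alpha).$$ For $x,y\in I$, $$\mathrm{LEPS}_{\mathrm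 r}(x,y)=3\bigl(1-|G(x)-G(y)|+G(x)^2-G(x)+G(y)^2-G(y)\bigr)-1,$$ and $\mathrm{GRIN}(x,y)=-\ln(G(x)(1-G(y)))-1$ if $x\ge y$, $\mathrm{GRIN}(x,y)=-\ln(G(y)(1-G(x)))-1$ if $x<y$. A scoring function $S:\mathcal{F}\times\mathcal{O}\to[-\infty,\infty]$ is equitable with respect to a distribution $G$ on $\mathcal{O}$ if there is $c\in\mathbb{R}$ (the equitability constant) with $\mathbb{E}_G S(x,Y)=c$ for every $x\in\mathcal{F}$, where $Y$ has distribution $G$. A scoring function $S'$ on $\mathcal{F}\times\mathcal{O}$ is equivalent to $S$ if there exist a nonzero constant $a$ and a function $h:\mathcal{O}\to\mathbb{R}$ with $S'(x,y)=aS(x,y)+h(y)$ for all $x\in\mathcal{F}$, $y\in\mathcal{O}$. *)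

(* Defs.v *)
From mathcomp Require Import all_boot all_order all_algebra.
From mathcomp Require Import all_classical all_reals all_analysis.

Set Implicit Arguments.
Unset Strict Implicit.
Unset Printing Implicit Defensive.

Import Order.TTheory GRing.Theory Num.Theory.
Import numFieldNormedType.Exports.

Local Open Scope classical_set_scope.
Local Open Scope ring_scope.

(* [measurableTypeR R] is R with its Borel sigma-algebra. A scoring function on
   I x I is a function R -> R -> \bar R that is only looked at on I x I. *)

Section distribution_functions.
Context {R : realType}.
Implicit Types (I : set R) (G : R -> R) (P : probability (measurableTypeR R) R).

(* The law P, identified with its right-continuous CDF. *)
Definition cdfr P : R -> R := fun z => fine (P `]-oo, z]%classic).

Definition domD G : set R := [set z | 0 < G z < 1].

Definition ranR G : set R := [set a | 0 < a < 1 /\ exists z, G z = a].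

(* The least z such that G z >= a; for a CDF G and 0 < a < 1 it exists. *)
Definition quantile G (a : R) : R :=
  get [set z | a <= G z /\ forall w, a <= G w -> z <= w].

Definition increasing_on (D : set R) G : Prop :=
  forall z w, D z -> D w -> z < w -> G z < G w.

Definition condG1 G : Prop := continuous G /\ increasing_on (domD G) G.

Definition condG2 I G : Prop :=
  [/\ I = [set z | 0 <= z],
      G z @[z --> 0^'-] --> (0 : R) /\ 0 < G 0,
      (forall z, 0 < z -> {for z, continuous G})
    & increasing_on (domD G) G].

Definition condG3 G : Prop := condG1 G /\ forall z, 0 < G z < 1.

Definition condG4 I G : Prop := condG2 I G /\ forall z, G z < 1.

End distribution_functions.

Section measures_on_the_unit_interval.
Context {R : realType}.
Implicit Types (mu : {measure set (measurableTypeR R) -> \bar R}) (u f : R -> R).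

(* A Borel measure on (0,1) is given by a Borel measure on R of which only the
   values on Borel subsets of (0,1) are ever used. It need not be finite. *)

Definition atomless01 mu : Prop := forall a : R, 0 < a < 1 -> mu [set a] = 0%E.

(* d mu (a) = u a da on (0,1) *)
Definition has_density01 mu u : Prop :=
  forall A : set (measurableTypeR R), measurable A -> A `<=` `]0, 1[ ->
    mu A = (\int[@lebesgue_measure R]_(a in A) (u a)%:E)%E.

(* The integral of f from a to b, with the sign reversed if a > b. For
   a and b in [0,1] the open interval of integration stays inside (0,1), also
   when an endpoint is 0 or 1. *)
Definition oriented_integral mu (a b : R) f : \bar R :=
  if a <= b then (\int[mu]_(t in `]a, b[) (f t)%:E)%E
  else (- \int[mu]_(t in `]b, a[) (f t)%:E)%E.

End measures_on_the_unit_interval.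

Section scoring_functions.
Context {R : realType}.
Implicit Types (I : set R) (G : R -> R) (S : R -> R -> \bar R).
Implicit Types (P : probability (measurableTypeR R) R).

(* The expectation of S(x, Y) for Y ~ P exists and equals c, for all x in I. *)
Definition equitable_const I P S (c : R) : Prop :=
  forall x, I x ->
    P.-integrable I (S x) /\ (\int[P]_(y in I) S x y)%E = c%:E.

Definition equitable I P S : Prop := exists c : R, equitable_const I P S c.

Definition equivalent_score I S' S : Prop :=
  exists (a : R) (h : R -> R), a != 0 /\
    forall x y, I x -> I y -> S' x y = (a%:E * S x y + (h y)%:E)%E.

Definition GDSd G (mu : {measure set (measurableTypeR R) -> \bar R})
    (x y : R) : \bar R :=
  (\int[mu]_(a in ranR G)
     (((y < x)%R%:R - a) *
      ((quantile G a < x)%R%:R - (quantile G a < y)%R%:R))%:E)%E.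

Definition LEPSr G (x y : R) : R :=
  3 * (1 - `|G x - G y| + G x ^+ 2 - G x + G y ^+ 2 - G y) - 1.

Definition GRIN G (x y : R) : R :=
  if y <= x then - ln (G x * (1 - G y)) - 1
  else - ln (G y * (1 - G x)) - 1.

Definition S1 G (x y : R) : R :=
  ((y < x)%R%:R - G y) ^+ 2 - ((y < x)%R%:R - G x) ^+ 2.

Definition S2 G (x y : R) : R :=
  ln `| ((x < y)%R%:R - G x) / ((x < y)%R%:R - G y) |.

Definition intU (u : R -> R) (z : R) : R :=
  \int[@lebesgue_measure R]_(a in `]0, z[) u a.

Definition intV (u : R -> R) (z : R) : R :=
  \int[@lebesgue_measure R]_(a in `]0, z[) (a * u a).

Definition S3 (u : R -> R) G (x y : R) : R :=
  (y < x)%R%:R * (intU u (G x) - intU u (G y)) - intV u (G x) + intV u (G y).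

End scoring_functions.

(* Main.v *)
Require Import Defs.
From HB Require Import structures.
From mathcomp Require Import all_boot all_order all_algebra.
From mathcomp Require Import all_classical all_reals all_analysis.
From mathcomp Require Import measurable_realfun ring lra.

Set Implicit Arguments.
Unset Strict Implicit.
Unset Printing Implicit Defensive.

Import Order.TTheory GRing.Theory Num.Theory.
Import numFieldNormedType.Exports.

Local Open Scope classical_set_scope.
Local Open Scope ring_scope.

(** Write g = G x and h = G y. On the range of G the quantile of a lies below x
exactly when a < g, so the integrand of the score is 1 - a for h <= a < g,
it is a for g <= a < h, and it vanishes elsewhere. Hence the score only sees the
interval between g and h: it is the [gap_score] of g and h, an integral of 1 - a
or of a over that interval. A measure without atoms makes the endpoints
irrelevant, which gives (i) ([GDSd_gap_score]).

The three explicit scores are the gap scores of the densities 2,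
1 / (a (1 - a)) and u. If mu has density u, integrals against mu become Lebesgue
integrals against u ([has_density01_gap_score]), and the latter are evaluated by
the fundamental theorem of calculus ([gap_score_brier], [gap_score_log]) or
by the definition of U and V ([gap_score_primitives]).

Equitability is one computation for all of them. By Tonelli's theorem the
expectation of the gap score over y ~ G is an integral over the levels a of u(a)
times (1 - a) P(G(Y) < a) if a <= g, and times a P(G(Y) > a) if g < a. Above the
smallest level b of the range of G (b = 0 under G1, b = G(0) under G2) the
variable G(Y) is uniform: P(G(Y) < a) = a and P(G(Y) > a) = 1 - a. Both cases
thus give the same weight a (1 - a) u(a), whatever x is. Levels below b contribute
nothing, because they are below g and G(Y) >= b almost surely. So the expectation
is the integral of a (1 - a) u(a) over ]b, 1[ ([expectation_gap_score]).

The two conditions on G enter only through [regular_cdf], which records what they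
have in common. *)

(** * Distribution functions *)

Section cdf_facts.
Context {R : realType} (P : probability (measurableTypeR R) R).
Implicit Types (I : set R) (a b z w : R).
Local Notation G := (cdfr P).

Lemma cdfrE z : (G z)%:E = P `]-oo, z]%classic.
Proof. by rewrite /cdfr fineK// fin_num_measure. Qed.

Lemma cdfr_ge0 z : 0 <= G z.
Proof. by rewrite -lee_fin cdfrE. Qed.

Lemma cdfr_le1 z : G z <= 1.
Proof. by rewrite -lee_fin cdfrE probability_le1. Qed.

Lemma cdfr01 z : 0 <= G z <= 1.
Proof. by rewrite cdfr_ge0 cdfr_le1. Qed.

Lemma cdfr_homo : {homo G : z w / z <= w}.
Proof.
move=> z w zw; rewrite -lee_fin !cdfrE le_measure ?inE//.
by apply: subset_itvl; rewrite bnd_simp.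
Qed.

Lemma cdfr_lt z w : G z < G w -> z < w.
Proof. by move=> h; rewrite ltNge; apply/negP => /cdfr_homo; rewrite leNgt h. Qed.

Lemma measurable_cdfr : measurable_fun [set: measurableTypeR R] G.
Proof. by apply: nondecreasing_measurable => //; exact: cdfr_homo. Qed.

(* Under the law P the identity is a random variable with distribution
   function G; this gives access to the limits of G. *)
Let idR : measurableTypeR R -> R := idfun.

#[local] HB.instance Definition _ :=
  @isMeasurableFun.Build _ _ _ _ idR (@measurable_id _ _ setT).

Lemma cdfr_cdf : G = fine \o cdf (idR : {RV P >-> R}).
Proof. by []. Qed.

Lemma cdfr_right_continuous z : G w @[w --> z^'+] --> G z.
Proof.
rewrite {1}cdfr_cdf; apply: fine_cvg; rewrite cdfrE.
exact: (@cdf_right_continuous _ _ _ P (idR : {RV P >-> R}) z).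
Qed.

(** The set of all w with a <= G w is nonempty because G tends to 1 at +oo and
bounded below because G tends to 0 at -oo; right continuity puts its infimum
into the set. *)
Lemma cdfr_quantile a : 0 < a < 1 ->
  exists z, a <= G z /\ forall w, a <= G w -> z <= w.
Proof.
move=> /andP[a0 a1].
have [r ar] : exists r, a < G r.
  have : G w @[w --> +oo] --> (1 : R).
    by rewrite cdfr_cdf; exact/fine_cvg/(@cvg_cdfy1 _ _ _ P (idR : {RV P >-> R})).
  move=> /cvgr_gt /(_ _ a1) h.
  near (pinfty_nbhs R) => r; exists r; near: r; exact: h.
have [l la] : exists l, G l < a.
  have : G w @[w --> -oo] --> (0 : R).
    by rewrite cdfr_cdf; exact/fine_cvg/(@cvg_cdfNy0 _ _ _ P (idR : {RV P >-> R})).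
  move=> /cvgr_lt /(_ _ a0) h.
  near (ninfty_nbhs R) => l; exists l; near: l; exact: h.
pose A := [set w | a <= G w].
have hA : has_inf A.
  split; first by exists r; exact: ltW.
  by exists l => w /= aw; apply/ltW/cdfr_lt; exact: lt_le_trans aw.
have infA w : a <= G w -> inf A <= w by move=> aw; apply: ge_inf => //; case: hA.
exists (inf A); split => //.
rewrite -(cvg_lim _ (@cdfr_right_continuous (inf A)))//.
apply: limr_ge; first by apply/cvg_ex; exists (G (inf A)); exact: cdfr_right_continuous.
near=> w.
have [v Av vw] : exists2 v, A v & v < w by apply: inf_lt => //; case: hA.
by apply: le_trans Av _; exact/cdfr_homo/ltW.
Unshelve. all: by end_near. Qed.

(** The common content of G1 (with b = 0) and G2 (with b = G 0): above the level b
the law is continuous, so that the range of G is the part of ]0, 1[ from b on, and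
the law of Y has no mass where G < b. *)
Record regular_cdf I b : Prop := RegularCdf {
  regular_ge0 : 0 <= b;
  regular_le1 : b <= 1;
  regular_continuous : forall z, b < G z -> {for z, continuous G};
  regular_increasing : increasing_on (domD G) G;
  regular_gap : forall z, 0 < G z -> b <= G z;
  regular_attained : 0 < b -> exists z, G z = b;
  regular_support : forall x, I x -> b <= G x
}.

Lemma condG1_regular I : condG1 G -> regular_cdf I 0.
Proof.
move=> [cG iG]; split=> //.
- by move=> z _; exact: cG.
- by move=> z /ltW.
- by rewrite ltxx.
- by move=> x _; exact: cdfr_ge0.
Qed.

Lemma condG2_regular I : condG2 I G -> regular_cdf I (G 0).
Proof.
move=> [-> [G0 _] cG iG].
have Gneg z : z < 0 -> G z = 0.
  move=> z0; apply/le_anti; rewrite cdfr_ge0 andbT -(cvg_lim _ G0)//.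
  apply: limr_ge; first by apply/cvg_ex; exists 0.
  by near=> w; apply: cdfr_homo; near: w; exact: nbhs_left_ge.
split=> //.
- exact: cdfr_ge0.
- exact: cdfr_le1.
- by move=> z /cdfr_lt; exact: cG.
- move=> z; have [/Gneg ->|z0 _] := ltP z 0; first by rewrite ltxx.
  exact: cdfr_homo.
- by move=> _; exists 0.
- by move=> x /= /cdfr_homo.
Unshelve. all: by end_near. Qed.

Section regular.
Context I b (rG : regular_cdf I b).

(** A level strictly between 0 and 1 is attained at one point only, since G
increases strictly where 0 < G < 1. Comparing G w with the level therefore amounts to
comparing w with that point. *)
Lemma level_lt a z w : 0 < a < 1 -> G z = a -> (G w < a) = (w < z).
Proof.
move=> a01 Gz; apply/idP/idP => [|wz]; first by rewrite -Gz; exact: cdfr_lt.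
rewrite lt_neqAle -{2}Gz (cdfr_homo (ltW wz)) andbT; apply/eqP => Gw.
have := regular_increasing rG _ _ wz.
by rewrite /domD/= Gz Gw ltxx => /(_ a01 a01).
Qed.

Lemma level_le a z w : 0 < a < 1 -> G z = a -> (G w <= a) = (w <= z).
Proof.
move=> a01 Gz; apply/idP/idP => [|wz]; last by rewrite -Gz; exact: cdfr_homo.
rewrite !leNgt; apply: contra => zw.
rewrite lt_neqAle -{2}Gz (cdfr_homo (ltW zw)) andbT; apply/eqP => aGw.
have := regular_increasing rG _ _ zw.
by rewrite /domD/= Gz -aGw ltxx => /(_ a01 a01).
Qed.

(** The quantile z of a satisfies a <= G z. Every w < z has G w < a, so the left
limit of G at z is at most a, and it is G z because G is continuous at z. *)
Lemma level_exists a : b < a -> 0 < a < 1 -> exists z, G z = a.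
Proof.
move=> ba /[dup] a01 /cdfr_quantile[z [az zmin]]; exists z.
have cz : {for z, continuous G}.
  by apply: regular_continuous rG _ _; exact: lt_le_trans az.
apply/le_anti; rewrite az andbT -(cvg_lim _ (cvg_at_left_filter cz))//.
apply: limr_le; first by apply/cvg_ex; exists (G z); exact: cvg_at_left_filter cz.
near=> w; rewrite leNgt; apply/negP => /ltW /zmin; apply/negP; rewrite -ltNge.
by near: w; exact: nbhs_left_lt.
Unshelve. all: by end_near. Qed.

Lemma ranRE a : ranR G a <-> 0 < a < 1 /\ b <= a.
Proof.
split=> [[a01 [z Gz]]|[a01]].
  by split=> //; rewrite -Gz; apply: regular_gap rG _ _; rewrite Gz; case/andP: a01.
rewrite le_eqVlt => /predU1P[ba|ba]; split=> //; last exact: level_exists.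
by rewrite -ba; apply: regular_attained rG _; rewrite ba; case/andP: a01.
Qed.

Lemma quantile_lt a x : ranR G a -> (quantile G a < x) = (a < G x).
Proof.
move=> [a01 [z Gz]].
suff -> : quantile G a = z by rewrite !ltNge (level_le _ a01 Gz).
apply: get_unique => /=.
  by split=> [|w]; rewrite ?Gz// leNgt (level_lt _ a01 Gz) -leNgt.
move=> y [ay ymin]; apply/le_anti; rewrite ymin ?Gz//=.
by move: ay; rewrite leNgt (level_lt _ a01 Gz) -leNgt.
Qed.

(** Together with [prob_cdfr_lt] and [prob_cdfr_below]: G(Y) is uniform above b,
and below b it has no mass. *)
Lemma prob_cdfr_gt a : b < a -> 0 < a < 1 -> P [set y | a < G y] = (1 - a)%:E.
Proof.
move=> ba a01; have [z Gz] := level_exists ba a01.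
have -> : [set y | a < G y] = ~` `]-oo, z]%classic.
  by apply/seteqP; split=> y /=; rewrite in_itv/= ltNge (level_le _ a01 Gz) => /negP.
by rewrite probability_setC// -cdfrE Gz.
Qed.

Lemma prob_cdfr_lt a : b < a -> 0 < a < 1 -> P [set y | G y < a] = a%:E.
Proof.
move=> ba a01; have [z Gz] := level_exists ba a01.
have -> : [set y | G y < a] = `]-oo, z[%classic.
  by apply/seteqP; split=> y /=; rewrite in_itv/= (level_lt _ a01 Gz).
(* The open half-line has probability at most G z and, by monotonicity, at least
   the left limit of G at z; the two agree. *)
apply/le_anti/andP; split.
  rewrite -Gz cdfrE le_measure ?inE//.
  by apply: subset_itvl; rewrite bnd_simp.
have cz : {for z, continuous G} by apply: regular_continuous rG _ _; rewrite Gz.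
rewrite -Gz -[X in (_ <= X)%E]fineK ?fin_num_measure// lee_fin.
rewrite -(cvg_lim _ (cvg_at_left_filter cz))//.
apply: limr_le; first by apply/cvg_ex; exists (G z); exact: cvg_at_left_filter cz.
near=> w; rewrite -lee_fin cdfrE fineK ?fin_num_measure// le_measure ?inE//.
apply: subset_itvl; rewrite bnd_simp; near: w; exact: nbhs_left_lt.
Unshelve. all: by end_near. Qed.

Lemma prob_cdfr_below a : is_interval I -> P I = 1%E -> a <= b ->
  P [set y | G y < a] = 0%E.
Proof.
move=> /is_interval_measurable mI P_I ab.
have PC : P (~` I) = 0%E by rewrite probability_setC// P_I subee.
apply: (subset_measure0 _ _ _ PC) => //; last first.
- by move=> y /= ya /(regular_support rG); apply/negP; rewrite -ltNge (lt_le_trans ya).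
- exact: measurableC.
rewrite (_ : [set y | G y < a] = [set: _] `&` G @^-1` `]-oo, a[%classic).
  exact: measurable_cdfr.
by rewrite setTI; apply/seteqP; split=> y /=; rewrite in_itv.
Qed.

End regular.
End cdf_facts.

(** * The score as an integral between two levels *)

Section gap_score.
Context {R : realType}.
Implicit Types (mu : {measure set (measurableTypeR R) -> \bar R}).
Implicit Types (u f : R -> R) (a b g h p q : R).

(** The generalized discrimination score in probability space, for the measure
u dmu and the levels g = G x and h = G y. The signs are absorbed into the two
cases, so that for u >= 0 and levels in [0, 1] only nonnegative functions are
integrated and infinite values are harmless. *)
Definition gap_score mu u g h : \bar R :=
  if h <= g then (\int[mu]_(a in `]h, g[) ((1 - a) * u a)%:E)%E
  else (\int[mu]_(a in `]g, h[) (a * u a)%:E)%E.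

Lemma gap_score_ge0 mu u g h : 0 <= g <= 1 -> 0 <= h <= 1 ->
  (forall a, 0 < a < 1 -> 0 <= u a) -> (0 <= gap_score mu u g h)%E.
Proof.
move=> g01 h01 u0; rewrite /gap_score; case: ifP => _; apply: integral_ge0 => a /=;
  rewrite in_itv/= lee_fin => ?; apply: mulr_ge0; rewrite ?u0//; lra.
Qed.

Lemma gap_score_le mu u g h : h <= g ->
  gap_score mu u g h = (\int[mu]_(a in `]h, g[) ((1 - a) * u a)%:E)%E.
Proof. by rewrite /gap_score => ->. Qed.

Lemma gap_score_ge mu u g h : g <= h ->
  gap_score mu u g h = (\int[mu]_(a in `]g, h[) (a * u a)%:E)%E.
Proof.
rewrite le_eqVlt /gap_score => /predU1P[->|/lt_geF -> //].
by rewrite lexx set_itvoo0 !integral_set0.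
Qed.

(** The sign of an oriented integral over a reversed interval cancels the sign of
the integrand 0 - a. When g = h both sides are integrals over the empty
interval. *)
Lemma oriented_integral_gap_score mu g h (t : bool) : 0 <= g <= 1 -> 0 <= h <= 1 ->
  (h < g -> t) -> (g < h -> ~~ t) ->
  oriented_integral mu h g (fun a => t%:R - a) = gap_score mu (fun=> 1) g h.
Proof.
move=> g01 h01 hg gh; rewrite /oriented_integral /gap_score.
have [hg'|gh'|->] := ltgtP h g.
- by rewrite hg//; apply: eq_integral => a _; rewrite mulr1.
- rewrite (negbTE (gh gh')) (@eq_integral _ _ _ mu _ (fun a => - (a * 1)%:E)%E); last first.
    by move=> a _; rewrite sub0r mulr1 EFinN.
  rewrite integral_ge0N ?oppeK//.
  by move=> a /=; rewrite in_itv/= lee_fin mulr1 => ?; lra.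
- by rewrite set_itvoo0 !integral_set0.
Qed.

(** The difference of the two indicators is the indicator of [p, q[. On the range
D of a regular G, this is ]p, q[ and possibly the single point p, which has
measure zero. *)
Lemma integral_gap mu (D : set R) f b p q : atomless01 mu ->
  (forall a, D a <-> 0 < a < 1 /\ b <= a) ->
  0 <= p -> p <= q -> q <= 1 -> b <= p ->
  measurable_fun [set: measurableTypeR R] f -> (forall a, 0 < a < 1 -> 0 <= f a) ->
  (\int[mu]_(a in D) (f a * ((a < q)%R%:R - (a < p)%R%:R))%:E =
   \int[mu]_(a in `]p, q[) (f a)%:E)%E.
Proof.
move=> amu DE p0 pq q1 bp mf f0.
have mfE (A : set (measurableTypeR R)) : measurable_fun A (EFin \o f).
  by apply: measurable_funTS; exact/measurable_EFinP.
pose fE : measurableTypeR R -> \bar R := EFin \o f.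
rewrite (@eq_integral _ _ _ mu _ (fE \_ `[p, q[)); last first.
  move=> a _; rewrite patchE mem_setE in_itv/= leNgt.
  have [aq|qa] := ltP a q; have [ap|pa] := ltP a p => /=.
  - by rewrite subrr mulr0.
  - by rewrite subr0 mulr1.
  - by have := le_lt_trans (le_trans pq qa) ap; rewrite ltxx.
  - by rewrite subrr mulr0.
rewrite -integral_mkcondr.
have -> : D `&` `[p, q[ = `]0, 1[ `&` `[p, q[.
  apply/seteqP; split=> a /=; rewrite !in_itv/= => -[].
    by move=> /DE[].
  by move=> a01 /[dup] /andP[pa _]; split=> //; apply/DE; split=> //; exact: le_trans pa.
have pN : mu (`]0, 1[ `&` [set p]) = 0%E.
  have [p01|p01] := boolP (0 < p < 1).
    apply: (subset_measure0 _ _ _ (amu _ p01)) => //.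
    exact: measurableI.
  rewrite (_ : _ `&` _ = set0) ?measure0//.
  by apply/seteqP; split=> a //= -[+ ap]; rewrite ap in_itv/= (negbTE p01).
rewrite (ge0_negligible_integral _ _ _ _ pN)//.
- congr (integral _ _ _); apply/seteqP; split=> a /=; rewrite !in_itv/=.
    move=> [[a01 /andP[pa aq]] /not_andP[//|/eqP ap]].
    by rewrite lt_neqAle eq_sym ap pa.
  move=> /andP[pa aq]; split; first lra.
  by move=> [_ ap]; move: pa; rewrite ap ltxx.
- exact: measurableI.
- exact: measurableI.
- by move=> a [/= + _]; rewrite in_itv/= lee_fin => /f0.
Qed.

End gap_score.

Section GDSd_gap_score.
Context {R : realType} (P : probability (measurableTypeR R) R).
Implicit Types (mu : {measure set (measurableTypeR R) -> \bar R}).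
Local Notation G := (cdfr P).

(** Since G is monotone, the sign of x - y fixes the order of the levels G x and
G y; if these coincide, both sides vanish. *)
Lemma GDSd_gap_score mu I b x y : regular_cdf P I b -> atomless01 mu -> I x -> I y ->
  GDSd G mu x y = gap_score mu (fun=> 1) (G x) (G y).
Proof.
move=> rG amu Ix Iy; rewrite /GDSd.
have Exy a : (a \in ranR G) -> (((y < x)%R%:R - a) *
      ((quantile G a < x)%R%:R - (quantile G a < y)%R%:R))%:E =
      (((y < x)%R%:R - a) * ((a < G x)%R%:R - (a < G y)%R%:R))%:E.
  by move=> /[!inE] ra; rewrite !(quantile_lt rG).
rewrite (@eq_integral _ _ _ mu _ _ _ Exy).
have [yx|xy] := ltP y x.
  rewrite gap_score_le; last exact/cdfr_homo/ltW.
  rewrite (integral_gap amu (ranRE rG)) ?cdfr_ge0 ?cdfr_le1//.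
  - by apply: eq_integral => a _; rewrite mulr1.
  - exact/cdfr_homo/ltW.
  - exact: regular_support rG _ _.
  - by apply: measurable_funB.
  - by move=> a /andP[_ /ltW]; rewrite subr_ge0.
rewrite gap_score_ge; last exact: cdfr_homo.
under [RHS]eq_integral do rewrite mulr1.
rewrite -(integral_gap amu (ranRE rG)) ?cdfr_ge0 ?cdfr_le1//.
- by apply: eq_integral => a _; rewrite sub0r mulNr -mulrN opprB.
- exact: cdfr_homo.
- exact: regular_support rG _ _.
- by move=> a /andP[/ltW].
Qed.

End GDSd_gap_score.

(** * Measures with a density *)

Section density.
Local Open Scope ereal_scope.
Context d (T : measurableType d) (R : realType).
Variables (nu mu : {measure set T -> \bar R}) (E : set T) (w : T -> R).
Hypotheses (mE : measurable E) (mw : measurable_fun E w)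
  (w0 : forall x, E x -> (0 <= w x)%R)
  (nuE : forall A, measurable A -> A `<=` E -> nu A = \int[mu]_(x in A) (w x)%:E).

Import HBNNSimple.

Let wE := EFin \o w.

Let mwE : measurable_fun E wE.
Proof. exact/measurable_EFinP. Qed.

Let integral_density_nnsfun (h : {nnsfun T >-> R}) :
  \int[nu]_(x in E) (h x)%:E = \int[mu]_(x in E) ((h x)%:E * (w x)%:E).
Proof.
have mindic r : measurable_fun E (fun x => (r * \1_(h @^-1` [set r]) x)%:E).
  by apply: (measurable_comp measurableT) => //; exact: measurable_funM.
transitivity (\int[nu]_(x in E)
   (\sum_(y \in range h) (y * \1_(h @^-1` [set y]) x)%:E)).
  by apply: eq_integral => t tE; rewrite /= fimfunE -fsumEFin.
rewrite ge0_integral_fsum//; last by move=> m y Ey; exact: nnfun_muleindic_ge0.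
transitivity (\int[mu]_(x in E) (\sum_(y \in range h)
    (y * \1_(h @^-1` [set y]) x)%:E * wE x)); last first.
  under [RHS]eq_integral => x xE.
    rewrite (fimfunE h x) -fsumEFin// ge0_mule_fsuml; last first.
      by move=> y; exact: nnfun_muleindic_ge0.
    over.
  by [].
rewrite ge0_integral_fsum//; last 2 first.
  - by move=> y; exact: emeasurable_funM.
  - move=> m y Ey; apply: mule_ge0; first exact: nnfun_muleindic_ge0.
    by rewrite lee_fin w0.
apply: eq_fsbigr => r rhn.
under eq_integral do rewrite EFinM.
rewrite integralZl_indic_nnsfun// integral_indic//.
under [RHS]eq_integral do rewrite EFinM -muleA.
have [r0|r0] := ltP r 0%R.
  rewrite preimage_nnfun0// set0I measure0 mule0.
  by rewrite integral0_eq// => x _; rewrite indicE in_set0 mul0e mule0.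
have mhr : measurable (h @^-1` [set r]) by [].
rewrite ge0_integralZl//.
- congr (_ * _); rewrite nuE//; first last.
  + exact: measurableI.
  rewrite setIC integral_mkcondr; apply: eq_integral => x xE.
  by rewrite epatch_indic muleC.
- apply: emeasurable_funM => //.
  exact/measurable_EFinP.
- by move=> x Ex; rewrite mule_ge0// lee_fin w0.
Qed.

(** The hypothesis on nu settles indicators, linearity settles nonnegative simple
functions, and monotone convergence does the rest. The density is prescribed on
subsets of E only, as for a measure on the line seen as a measure on (0, 1). *)
Lemma ge0_integral_density (f : T -> \bar R) :
  measurable_fun E f -> (forall x, E x -> 0 <= f x) ->
  \int[nu]_(x in E) f x = \int[mu]_(x in E) (f x * (w x)%:E).
Proof.
move=> mf f0; pose h := nnsfun_approx mE mf.
have -> : \int[nu]_(x in E) f x =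
    lim (\int[nu]_(x in E) (EFin \o h n) x @[n --> \oo]).
  have fE x : E x -> f x = lim ((EFin \o h n) x @[n --> \oo]).
    by move=> Ex; apply/esym/cvg_lim => //; exact: cvg_nnsfun_approx.
  under eq_integral => x /[!inE] /fE -> //.
  apply: monotone_convergence => //.
  - move=> n; apply/measurable_EFinP.
    by apply: (measurable_funS measurableT) => //; exact/measurable_funP.
  - by move=> n x Ex //=; rewrite lee_fin.
  - by move=> x Ex a b ab; rewrite lee_fin; exact/lefP/nd_nnsfun_approx.
have -> : \int[mu]_(x in E) (f x * (w x)%:E) =
    lim (\int[mu]_(x in E) ((EFin \o h n) \* wE) x @[n --> \oo]).
  have fg x : E x -> f x * wE x = lim (((EFin \o h n) \* wE) x @[n --> \oo]).
    by move=> Ex; apply/esym/cvg_lim => //; apply: cvgeZr;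
      [by []|exact: cvg_nnsfun_approx].
  under eq_integral => x /[!inE] /fg -> //.
  apply: monotone_convergence => [//| | |].
  - move=> n; apply/emeasurable_funM => //; apply/measurable_funTS.
    exact/measurable_EFinP.
  - by move=> n x Ex /=; rewrite mule_ge0 ?lee_fin ?w0.
  - move=> x Ex a b ab/=; rewrite lee_wpmul2r ?lee_fin ?w0//.
    exact/lefP/nd_nnsfun_approx.
by under eq_fun do rewrite integral_density_nnsfun.
Qed.

End density.

Section density01.
Context {R : realType}.
Implicit Types (mu : {measure set (measurableTypeR R) -> \bar R}) (u : R -> R).

Lemma has_density01_atomless mu u : has_density01 mu u -> atomless01 mu.
Proof.
move=> hmu a a01; rewrite hmu ?integral_set1//.
by move=> _ /= ->; rewrite in_itv.
Qed.

Lemma has_density01_integral mu u (f : R -> R) (p q : R) : has_density01 mu u ->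
  measurable_fun (`]0, 1[ : set (measurableTypeR R)) u ->
  (forall a, 0 < a < 1 -> 0 <= u a) ->
  measurable_fun [set: measurableTypeR R] f -> (forall a, 0 < a < 1 -> 0 <= f a) ->
  0 <= p -> q <= 1 ->
  (\int[mu]_(a in `]p, q[) (f a)%:E =
   \int[@lebesgue_measure R]_(a in `]p, q[) (f a * u a)%:E)%E.
Proof.
move=> hmu mu0 u0 mf f0 p0 q1.
have pq01 : `]p, q[ `<=` `]0, 1[.
  by move=> a /=; rewrite !in_itv/= => ?; lra.
rewrite (@ge0_integral_density _ _ _ _ (@lebesgue_measure R) _ u)//.
- exact: measurable_funS mu0.
- by move=> a /pq01; rewrite /= in_itv => /u0.
- by move=> A mA Apq; apply: hmu => //; exact: subset_trans pq01.
- by apply: measurable_funTS; exact/measurable_EFinP.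
- by move=> a /pq01; rewrite /= in_itv/= lee_fin => /f0.
Qed.

Lemma has_density01_gap_score mu u (g h : R) : has_density01 mu u ->
  measurable_fun (`]0, 1[ : set (measurableTypeR R)) u ->
  (forall a, 0 < a < 1 -> 0 <= u a) -> 0 <= g <= 1 -> 0 <= h <= 1 ->
  gap_score mu (fun=> 1) g h = gap_score (@lebesgue_measure R) u g h.
Proof.
move=> hmu mu0 u0 /andP[g0 g1] /andP[h0 h1]; rewrite /gap_score; case: ifP => _.
  under eq_integral do rewrite mulr1.
  rewrite (has_density01_integral hmu mu0)//; first exact: measurable_funB.
  by move=> a /andP[_ /ltW]; rewrite subr_ge0.
under eq_integral do rewrite mulr1.
by rewrite (has_density01_integral hmu mu0)// => a /andP[/ltW].
Qed.

End density01.

(** * The expectation of the score *)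

Section expectation.
Context {R : realType} (P : probability (measurableTypeR R) R).
Variables (I : set R) (b : R) (u : R -> R) (g : R).
Local Notation G := (cdfr P).
Local Notation lambda := (@lebesgue_measure R).
Hypotheses (itvI : is_interval I) (P_I : P I = 1%E) (rG : regular_cdf P I b).
Hypotheses (mu01 : measurable_fun (`]0, 1[ : set (measurableTypeR R)) u).
Hypotheses (u0 : forall a, 0 < a < 1 -> 0 <= u a).
Hypotheses (bg : b <= g) (g1 : g <= 1).

(* Tonelli's theorem is applied on the whole plane, so u is extended by 0 outside
   the unit interval. *)
Let u01 : measurableTypeR R -> R := u \_ `]0, 1[.

Let u01E a : 0 < a < 1 -> u01 a = u a.
Proof. by move=> a01; rewrite /u01 patchE mem_setE in_itv/= a01. Qed.

Let u01_out a : ~ (0 < a < 1) -> u01 a = 0.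
Proof. by move=> /negP /negbTE a01; rewrite /u01 patchE mem_setE in_itv/= a01. Qed.

(* The first component of z is the observation y, the second one the level a. The
   level a = g is put on the side a <= g: then every level a <= b falls in the
   first branch, where G y < a has probability zero, also when a = b = g. *)
Let kernel (z : measurableTypeR R * measurableTypeR R) : R :=
  u01 z.2 * (if z.2 <= g then (if G z.1 < z.2 then 1 - z.2 else 0)
             else (if z.2 < G z.1 then z.2 else 0)).

Let kernel_ge0 z : 0 <= kernel z.
Proof.
rewrite /kernel; have [z01|/u01_out ->] := pselect (0 < z.2 < 1); last by rewrite mul0r.
rewrite u01E// mulr_ge0 ?u0//.
by do ?[case: ifP => _ //]; lra.
Qed.

Let measurable_kernel : measurable_fun setT kernel.
Proof.
have mG : measurable_fun setT
    (fun z : measurableTypeR R * measurableTypeR R => G z.1).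
  exact: measurableT_comp (measurable_cdfr P) _.
apply: measurable_funM.
  apply: (measurableT_comp (f := u01)) => //.
  by apply/(measurable_restrictT u) => //; exact: measurable_itv.
apply: measurable_fun_ifT.
- exact: measurable_fun_ler.
- apply: measurable_fun_ifT => //; first exact: measurable_fun_ltr.
  exact: measurable_funB.
- by apply: measurable_fun_ifT => //; exact: measurable_fun_ltr.
Qed.

Let integral_kernel_level y :
  (\int[lambda]_a (kernel (y, a))%:E = gap_score lambda u g (G y))%E.
Proof.
have g0 : 0 <= g by apply: le_trans bg; exact: regular_ge0 rG.
have [y0 y1] := (cdfr_ge0 P y, cdfr_le1 P y).
rewrite /gap_score; case: ifPn => [yg|]; last rewrite -ltNge => gy.
  rewrite integral_itv_bndo_bndc; last first.
    apply/measurable_EFinP/measurable_funM; first exact: measurable_funB.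
    apply: measurable_funS mu01 => // a /=; rewrite !in_itv/= => /andP[ya ag].
    by rewrite (le_lt_trans y0 ya) (lt_le_trans ag g1).
  rewrite [RHS]integral_mkcond; apply: eq_integral => + _; move=> /= a.
  rewrite patchE mem_setE in_itv/= /kernel/=.
  have [ag|ga] := leP a g; last first.
    by rewrite andbF ltNge (le_trans yg (ltW ga)) mulr0.
  rewrite andbT; case: ifP => [ya|_]; last by rewrite mulr0.
  (* The extension of u vanishes at a = 1, and so does the factor 1 - a. *)
  have [a1|a1] := ltP a 1; first by rewrite u01E 1?mulrC// a1 (le_lt_trans y0).
  have -> : a = 1 by apply/le_anti; rewrite a1 (le_trans ag).
  by rewrite subrr mulr0 mul0r.
rewrite [RHS]integral_mkcond; apply: eq_integral => + _; move=> /= a.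
rewrite patchE mem_setE in_itv/= /kernel/=.
have [ag|ga] := leP a g; first by rewrite ltNge (le_trans ag (ltW gy)) mulr0.
case: ifP => [ay|_]; last by rewrite mulr0.
by rewrite u01E 1?mulrC// (le_lt_trans g0)//= (lt_le_trans ay).
Qed.

Let integral_kernel_obs (a : R) :
  (\int[P]_y (kernel (y, a))%:E)%E =
  ((fun a : R => (a * (1 - a) * u a)%:E) \_ `]b, 1[) a.
Proof.
have mA : measurable [set y : measurableTypeR R | a < G y].
  rewrite (_ : mkset _ = [set: _] `&` G @^-1` `]a, +oo[%classic).
    exact: measurable_cdfr.
  by rewrite setTI; apply/seteqP; split=> y /=; rewrite in_itv/= ?andbT.
have mB : measurable [set y : measurableTypeR R | G y < a].
  rewrite (_ : mkset _ = [set: _] `&` G @^-1` `]-oo, a[%classic).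
    exact: measurable_cdfr.
  by rewrite setTI; apply/seteqP; split=> y /=; rewrite in_itv.
have scaled (c : R) (A : set (measurableTypeR R)) : 0 <= c -> measurable A ->
    (\int[P]_y (c * \1_A y)%:E = c%:E * P A)%E.
  move=> c0 mC; under eq_integral do rewrite EFinM.
  rewrite ge0_integralZl//; first by rewrite integral_indic// setIT.
  exact/measurable_EFinP.
rewrite patchE mem_setE in_itv/=.
have [a01|a01] := pselect (0 < a < 1); last first.
  rewrite integral0_eq => [|y _]; last by rewrite /kernel u01_out ?mul0r.
  case: ifP => // /andP[ba a1]; exfalso; apply: a01.
  by rewrite a1 (le_lt_trans (regular_ge0 rG)).
have ua0 := u0 a01.
have [ag|ga] := leP a g.
  have c0 : 0 <= u a * (1 - a) by apply: mulr_ge0 => //; lra.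
  have -> : (\int[P]_y (kernel (y, a))%:E = (u a * (1 - a))%:E * P [set y | (G y < a)%R])%E.
    rewrite -scaled//; apply: eq_integral => y _; rewrite /kernel/= ag u01E//.
    by rewrite indicE; case: ifPn => [h|/negP h]; [rewrite mem_set// mulr1|rewrite memNset// !mulr0].
  have [ba|ab] := ltP b a.
    rewrite (prob_cdfr_lt rG)//; case/andP: (a01) => _ ->; rewrite -EFinM/=.
    by congr EFin; ring.
  by rewrite (prob_cdfr_below rG)// mule0.
have c0 : 0 <= u a * a by apply: mulr_ge0 => //; lra.
have ba := le_lt_trans bg ga.
have -> : (\int[P]_y (kernel (y, a))%:E = (u a * a)%:E * P [set y | (a < G y)%R])%E.
  rewrite -scaled//; apply: eq_integral => y _; rewrite /kernel/= leNgt ga u01E//=.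
  by rewrite indicE; case: ifPn => [h|/negP h]; [rewrite mem_set// mulr1|rewrite memNset// !mulr0].
rewrite (prob_cdfr_gt rG)// ba; case/andP: (a01) => _ ->; rewrite -EFinM/=.
by congr EFin; ring.
Qed.

Lemma measurable_gap_score :
  measurable_fun [set: measurableTypeR R] (fun y => gap_score lambda u g (G y)).
Proof.
apply: (eq_measurable_fun (fubini_F lambda (EFin \o kernel))).
  by move=> y _; rewrite -integral_kernel_level.
apply: measurable_fun_fubini_tonelli_F => //.
exact/measurable_EFinP.
Qed.

(** After exchanging the integrals, a level a in ]b, 1[ gets the weight
a * (1 - a) * u a on either side of g, so that g drops out. *)
Lemma expectation_gap_score :
  (\int[P]_(y in I) gap_score lambda u g (G y) =
   \int[lambda]_(a in `]b, 1%R[) (a * (1 - a) * u a)%:E)%E.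
Proof.
have PC : P (~` I) = 0%E.
  by rewrite probability_setC ?P_I ?subee//; exact: is_interval_measurable.
have mI : measurable (I : set (measurableTypeR R)) by exact: is_interval_measurable.
transitivity (\int[P]_y gap_score lambda u g (G y))%E.
  rewrite [RHS](ge0_negligible_integral _ _ _ _ PC)//.
  - by rewrite setDE setCK setTI.
  - exact: measurableC.
  - exact: measurable_gap_score.
  - move=> y _; apply: gap_score_ge0 => //; last exact: cdfr01.
    by rewrite g1 andbT (le_trans (regular_ge0 rG)).
under eq_integral do rewrite -integral_kernel_level.
rewrite (fubini_tonelli (EFin \o kernel))//; last exact/measurable_EFinP.
rewrite [RHS]integral_mkcond; apply: eq_integral => a _.
exact: integral_kernel_obs.
Qed.

End expectation.

(** * Closed forms for the densities 2 and 1 / (a (1 - a)) *)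

Section closed_forms.
Context {R : realType}.
Local Notation lambda := (@lebesgue_measure R).
Implicit Types (f F u : R -> R) (a b g h : R).

(** The two hypotheses on F and f are joined by a conjunction because [is_derive]
is a class: as a premise of its own it would be left to instance search. *)
Lemma integral_oo_antiderivative f F a b : a <= b ->
  (forall t, a <= t <= b -> is_derive t 1 F (f t) /\ {for t, continuous f}) ->
  (\int[lambda]_(t in `]a, b[) (f t)%:E = (F b - F a)%:E)%E.
Proof.
rewrite le_eqVlt => /predU1P[<- _|ab dcF].
  by rewrite set_itvoo0 integral_set0 subrr.
have dF s : a <= s <= b -> is_derive s 1 F (f s) by case/dcF.
have cf : {within `[a, b], continuous f}.
  apply: continuous_in_subspaceT => s; by rewrite inE/= in_itv/= => /dcF[].
have cF t : a <= t <= b -> {for t, continuous F}.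
  move=> /dF ?; apply/differentiable_continuous/derivable1_diffP.
  exact: ex_derive.
rewrite -(@integral_itv_bndoo _ a b (EFin \o f) true false); last first.
  apply/measurable_EFinP; apply: (@measurable_funS _ _ _ _ `[a, b]) => //.
    exact: subset_itv_oo_cc.
  exact: subspace_continuous_measurable_fun.
rewrite (@continuous_FTC2 _ f F _ _ ab cf) ?EFinB//.
- split.
  + by move=> t /[!in_itv]/= /andP[/ltW at_ /ltW tb]; apply: ex_derive; apply: dF; rewrite at_.
  + by apply: cvg_at_right_filter; apply: cF; rewrite lexx ltW.
  + by apply: cvg_at_left_filter; apply: cF; rewrite lexx ltW.
- move=> t /[!in_itv]/= /andP[/ltW at_ /ltW tb].
  by rewrite derive1E; apply: derive_val; apply: dF; rewrite at_.
Qed.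

Lemma gap_score_brier g h :
  gap_score lambda (fun=> 2) g h =
  (if h <= g then (1 - h) ^+ 2 - (1 - g) ^+ 2 else h ^+ 2 - g ^+ 2)%:E.
Proof.
rewrite /gap_score; case: ifPn => [hg|]; last rewrite -ltNge => /ltW gh.
  rewrite (@integral_oo_antiderivative _ (fun a => - (1 - a) ^+ 2))//.
  - by congr EFin; ring.
  - move=> t _; split.
      by apply: is_derive_eq; rewrite /GRing.scale/=; ring.
    apply: continuousM; last exact: cvg_cst.
    by apply: continuousB; [exact: cvg_cst|exact: cvg_id].
rewrite (@integral_oo_antiderivative _ (fun a => a ^+ 2))//.
- move=> t _; split.
    by apply: is_derive_eq; rewrite /GRing.scale/=; ring.
  by apply: continuousM; [exact: cvg_id|exact: cvg_cst].
Qed.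

Lemma integral_brier b : b <= 1 ->
  (\int[lambda]_(a in `]b, 1%R[) (a * (1 - a) * 2)%:E =
   (1 / 3 - b ^+ 2 + 2 * b ^+ 3 / 3)%:E)%E.
Proof.
move=> b1.
rewrite (@integral_oo_antiderivative _ (fun a => a ^+ 2 - (2 / 3) * a ^+ 3))//.
- by congr EFin; field.
- move=> t _; split.
    by apply: is_derive_eq; rewrite /GRing.scale/=; field.
  apply: continuousM; last exact: cvg_cst.
  apply: continuousM; first exact: cvg_id.
  by apply: continuousB; [exact: cvg_cst|exact: cvg_id].
Qed.

Lemma gap_score_log g h : 0 < g < 1 -> 0 < h < 1 ->
  gap_score lambda (fun a => (a * (1 - a))^-1) g h =
  (if h <= g then ln (g / h) else ln ((1 - g) / (1 - h)))%:E.
Proof.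
move=> /andP[g0 g1] /andP[h0 h1].
rewrite /gap_score; case: ifPn => [hg|]; last rewrite -ltNge => /ltW gh.
  rewrite (@eq_integral _ _ _ lambda _ (fun a => (a^-1)%:E)); last first.
    move=> a; rewrite inE/= in_itv/= => /andP[ha ag].
    by rewrite invfM mulrCA mulfV ?mulr1// subr_eq0 gt_eqF// (lt_trans ag).
  rewrite (@integral_oo_antiderivative _ (@ln R))//.
  - by rewrite ln_div ?posrE.
  - move=> t /andP[ht _]; split.
      by apply: is_derive1_ln; exact: lt_le_trans ht.
    by apply: inv_continuous; rewrite gt_eqF// (lt_le_trans h0).
rewrite (@eq_integral _ _ _ lambda _ (fun a => ((1 - a)^-1)%:E)); last first.
  move=> a; rewrite inE/= in_itv/= => /andP[ga ah].
  by rewrite invfM mulrA mulfV ?mul1r// gt_eqF// (lt_trans g0).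
rewrite (@integral_oo_antiderivative _ (fun a => - ln (1 - a)))//.
- by rewrite ln_div ?posrE ?subr_gt0//; congr EFin; ring.
- move=> t /andP[_ th].
  have t1 : 0 < 1 - t by rewrite subr_gt0 (le_lt_trans th).
  split.
    have dln := is_derive1_ln t1.
    have dl : is_derive t 1 (fun a : R => 1 - a) (-1).
      by apply: is_derive_eq; ring.
    have := is_deriveN (@is_derive1_comp _ (@ln R) (fun a => 1 - a) t _ _ dln dl).
    by rewrite mulrN1 opprK.
  apply: (@continuous_comp _ _ _ (fun a => 1 - a) GRing.inv).
    by apply: continuousB; [exact: cvg_cst|exact: cvg_id].
  by apply: inv_continuous; rewrite gt_eqF.
Qed.

Lemma integral_log b : 0 <= b <= 1 ->
  (\int[lambda]_(a in `]b, 1%R[) (a * (1 - a) * (a * (1 - a))^-1)%:E = (1 - b)%:E)%E.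
Proof.
move=> /andP[b0 b1].
rewrite (@eq_integral _ _ _ lambda _ (fun a => 1%:E)); last first.
  move=> a; rewrite inE/= in_itv/= => /andP[ba a1].
  rewrite mulfV// mulf_neq0// gt_eqF ?subr_gt0//.
  exact: le_lt_trans ba.
rewrite (@integral_oo_antiderivative (fun=> 1) id)//.
by move=> t _; split; [exact: is_derive_id|exact: cvg_cst].
Qed.

Lemma measurable_log_weight :
  measurable_fun (`]0, 1[ : set (measurableTypeR R)) (fun a : R => (a * (1 - a))^-1).
Proof.
apply: open_continuous_measurable_fun; first exact: itv_open.
move=> a; rewrite inE/= in_itv/= => /andP[a0 a1].
apply: (@continuous_comp _ _ _ (fun a => a * (1 - a)) GRing.inv).
  apply: continuousM; first exact: cvg_id.
  by apply: continuousB; [exact: cvg_cst|exact: cvg_id].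
by apply: inv_continuous; rewrite mulf_neq0// gt_eqF// subr_gt0.
Qed.

End closed_forms.

(** * The score of a bounded density *)

Section primitives.
Context {R : realType}.
Local Notation lambda := (@lebesgue_measure R).
Variable u : R -> R.
Hypotheses (mu01 : measurable_fun (`]0, 1[ : set (measurableTypeR R)) u).
Hypotheses (bu : exists M : R, forall a, 0 < a < 1 -> `|u a| <= M).

Let integrable01 (f : R -> R) : measurable_fun [set: measurableTypeR R] f ->
  (forall a, 0 < a < 1 -> `|f a| <= 1) ->
  lambda.-integrable `]0, 1[ (EFin \o (fun a => f a * u a)).
Proof.
move=> mf f1; apply: measurable_bounded_integrable => //.
- by rewrite /= lebesgue_measure_itv/=; case: ifP => // _; rewrite EFinN -EFinB ltry.
- by apply: measurable_funM => //; exact: measurable_funTS.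
- have [M uM] := bu; exists M; split; first exact: num_real.
  move=> M' MM' a /=; rewrite in_itv/= => a01.
  rewrite normrM (le_trans _ (ltW MM'))// -[leRHS]mul1r.
  by apply: ler_pM => //; [exact: f1|exact: uM].
Qed.

Let integrable_u : lambda.-integrable `]0, 1[ (EFin \o u).
Proof.
have -> : u = (fun a => 1 * u a) by apply/funext => a; rewrite mul1r.
by apply: (@integrable01 (fun=> 1)) => // a _; rewrite normr1.
Qed.

Let integrable_au : lambda.-integrable `]0, 1[ (EFin \o (fun a => a * u a)).
Proof. by apply: (@integrable01 id) => // a /andP[a0 /ltW a1]; rewrite gtr0_norm. Qed.

Let Rintegral_oo_diff (f : R -> R) h g : lambda.-integrable `]0, 1[ (EFin \o f) ->
  0 <= h -> h <= g -> g <= 1 ->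
  \int[lambda]_(a in `]0, g[) f a - \int[lambda]_(a in `]0, h[) f a =
  \int[lambda]_(a in `]h, g[) f a.
Proof.
move=> fi h0; rewrite le_eqVlt => /predU1P[<- _|hg g1].
  by rewrite subrr set_itvoo0 Rintegral_set0.
have sub (p q : R) : 0 <= p -> q <= 1 -> `]p, q[ `<=` `]0, 1[.
  move=> p0 q1 a /=; rewrite !in_itv/= => /andP[pa aq].
  by rewrite (le_lt_trans p0 pa) (lt_le_trans aq).
rewrite (@Rintegral_itv_bndo_bndc _ (BRight 0) h); last first.
  apply: integrableS fi => //; apply: sub => //.
  by rewrite (le_trans (ltW hg)).
apply: Rintegral_itvB; rewrite ?bnd_simp//.
by apply: integrableS fi => //; exact: sub.
Qed.

Lemma gap_score_primitives g h : 0 <= g <= 1 -> 0 <= h <= 1 ->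
  gap_score lambda u g h =
  ((h < g)%R%:R * (intU u g - intU u h) - intV u g + intV u h)%:E.
Proof.
move=> /andP[g0 g1] /andP[h0 h1].
have sub (p q : R) : 0 <= p -> q <= 1 -> `]p, q[ `<=` `]0, 1[.
  move=> p0 q1 a /=; rewrite !in_itv/= => /andP[pa aq].
  by rewrite (le_lt_trans p0 pa) (lt_le_trans aq).
have [hg|gh] := ltP h g.
  rewrite gap_score_le ?ltW//.
  rewrite (_ : _ - _ + _ =
    (intU u g - intU u h) - (intV u g - intV u h)); last by rewrite mul1r; ring.
  have hg' := ltW hg; rewrite /intU /intV !Rintegral_oo_diff//.
  have iu : lambda.-integrable `]h, g[ (EFin \o u).
    by apply: integrableS integrable_u => //; exact: sub.
  have iau : lambda.-integrable `]h, g[ (EFin \o (fun a => a * u a)).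
    by apply: integrableS integrable_au => //; exact: sub.
  rewrite -RintegralB// /Rintegral fineK.
    by apply: eq_integral => a _; rewrite mulrBl mul1r.
  by apply: integrable_fin_num => //; exact: (integrableB _ iu iau).
rewrite gap_score_ge// mul0r sub0r addrC.
rewrite /intV Rintegral_oo_diff// /Rintegral fineK//.
by apply: integrable_fin_num => //; apply: integrableS integrable_au => //; exact: sub.
Qed.

Lemma integral_weight_fine b : 0 <= b ->
  (\int[lambda]_(a in `]b, 1%R[) (a * (1 - a) * u a)%:E)%E =
  (\int[lambda]_(a in `]b, 1[) (a * (1 - a) * u a))%:E.
Proof.
move=> b0; rewrite /Rintegral fineK//; apply: integrable_fin_num => //.
have : lambda.-integrable `]0, 1[ (EFin \o (fun a => a * (1 - a) * u a)).
  apply: (@integrable01 (fun a => a * (1 - a))).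
    by apply: measurable_funM => //; exact: measurable_funB.
  move=> a /andP[a0 a1]; rewrite ger0_norm ?mulr_ge0 ?subr_ge0 ?ltW//.
  by nra.
by apply: integrableS => //; apply: subset_itvr; rewrite bnd_simp.
Qed.

End primitives.

(** * The explicit scores as gap scores *)

Section scores.
Context {R : realType} (P : probability (measurableTypeR R) R) (I : set R).
Local Notation G := (cdfr P).
Local Notation lambda := (@lebesgue_measure R).
Implicit Types (S : R -> R -> R) (u : R -> R).
Hypotheses (itvI : is_interval I) (P_I : P I = 1%E).

Section density_score.
Variables (u : R -> R) (S : R -> R -> R).
Hypotheses (mu01 : measurable_fun (`]0, 1[ : set (measurableTypeR R)) u).
Hypotheses (u0 : forall a, 0 < a < 1 -> 0 <= u a).
Hypothesis SE : forall x y, I x -> I y ->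
  (S x y)%:E = gap_score lambda u (G x) (G y).

Lemma density_score_ge0 x y : I x -> I y -> 0 <= S x y.
Proof.
move=> Ix Iy; rewrite -lee_fin SE//.
by apply: gap_score_ge0 => //; exact: cdfr01.
Qed.

Lemma density_score_GDSd b mu x y : regular_cdf P I b -> has_density01 mu u ->
  I x -> I y -> (S x y)%:E = GDSd G mu x y.
Proof.
move=> rG hmu Ix Iy.
rewrite SE// (GDSd_gap_score rG (has_density01_atomless hmu))//.
by rewrite (has_density01_gap_score hmu)//; exact: cdfr01.
Qed.

(** The expectation of a nonnegative score being the finite number c, the score is
integrable. *)
Lemma density_score_equitable b c : regular_cdf P I b ->
  (\int[lambda]_(a in `]b, 1%R[) (a * (1 - a) * u a)%:E)%E = c%:E ->
  equitable_const I P (fun x y => (S x y)%:E) c.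
Proof.
move=> rG cE x Ix.
have mI : measurable (I : set (measurableTypeR R)) by exact: is_interval_measurable.
have intS : (\int[P]_(y in I) (S x y)%:E = c%:E)%E.
  rewrite -cE -(expectation_gap_score itvI P_I rG mu01 u0 (g := G x)).
  - by apply: eq_integral => y; rewrite inE => Iy; rewrite SE.
  - exact: regular_support rG _ _.
  - exact: cdfr_le1.
split=> //; apply/integrableP; split.
  apply: (eq_measurable_fun (fun y => gap_score lambda u (G x) (G y))).
    by move=> y; rewrite inE => Iy; rewrite SE.
  apply: measurable_funTS.
  by apply: (measurable_gap_score rG) => //; [exact: regular_support rG _ _|exact: cdfr_le1].
rewrite (@eq_integral _ _ _ P _ (fun y => (S x y)%:E)) ?intS ?ltry// => y; rewrite inE => Iy.
by rewrite gee0_abs// lee_fin density_score_ge0.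
Qed.

End density_score.

Lemma S1_gap_score x y : (S1 G x y)%:E = gap_score lambda (fun=> 2) (G x) (G y).
Proof.
rewrite gap_score_brier /S1; have [yx|xy] := ltP y x.
  by rewrite (cdfr_homo P (ltW yx)).
have := cdfr_homo P xy; rewrite le_eqVlt => /predU1P[->|/lt_geF ->].
  by rewrite lexx !subrr.
by rewrite !sub0r !sqrrN.
Qed.

Lemma S2_gap_score x y : 0 < G x < 1 -> 0 < G y < 1 ->
  (S2 G x y)%:E = gap_score lambda (fun a => (a * (1 - a))^-1) (G x) (G y).
Proof.
move=> x01 y01; rewrite gap_score_log// /S2.
have [[x0 x1] [y0 y1]] := (andP x01, andP y01).
have [xy|yx] := ltP x y.
  rewrite ger0_norm; last by rewrite divr_ge0// subr_ge0 ltW.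
  have := cdfr_homo P (ltW xy); rewrite le_eqVlt => /predU1P[->|/lt_geF -> //].
  by rewrite lexx !divff// gt_eqF ?subr_gt0.
rewrite (cdfr_homo P yx) !sub0r invrN mulrNN ger0_norm//.
by rewrite divr_ge0// ltW.
Qed.

Lemma S3_gap_score u x y :
  measurable_fun (`]0, 1[ : set (measurableTypeR R)) u ->
  (exists M : R, forall a, 0 < a < 1 -> `|u a| <= M) ->
  (S3 u G x y)%:E = gap_score lambda u (G x) (G y).
Proof.
move=> mu bu; rewrite (gap_score_primitives mu bu) ?cdfr01// /S3.
have [yx|xy] := ltP y x; last by rewrite ltNge (cdfr_homo P xy).
have := cdfr_homo P (ltW yx); rewrite le_eqVlt => /predU1P[->|-> //].
by rewrite ltxx subrr !mulr0.
Qed.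

Lemma S1_le1 x y : S1 G x y <= 1.
Proof.
have /andP[x0 x1] := cdfr01 P x; have /andP[y0 y1] := cdfr01 P y.
by rewrite /S1; case: ltP => _ /=; nra.
Qed.

(** For fixed y the two scores differ by an affine map; the witnesses are found by
comparing the coefficients of G x, which is the same computation for x on either side of
y. *)
Lemma S1_LEPSr x y :
  S1 G x y = - 3^-1 * LEPSr G x y + (2 / 3 + 2 * G y ^+ 2 - 2 * G y).
Proof.
rewrite /S1 /LEPSr; have [yx|xy] := ltP y x.
  by rewrite ger0_norm ?subr_ge0 ?(cdfr_homo P (ltW yx))//=; field.
by rewrite ler0_norm ?subr_le0 ?(cdfr_homo P xy)//=; field.
Qed.

Lemma S2_GRIN x y : 0 < G x < 1 -> 0 < G y < 1 ->
  S2 G x y = - 1 * GRIN G x y + (- ln (G y) - ln (1 - G y) - 1).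
Proof.
move=> /andP[x0 x1] /andP[y0 y1]; rewrite /S2 /GRIN.
have [xy|yx] := ltP x y.
  rewrite ger0_norm; last by rewrite divr_ge0// subr_ge0 ltW.
  rewrite ln_div ?lnM ?posrE ?subr_gt0//.
  by ring.
rewrite !sub0r invrN mulrNN ger0_norm; last by rewrite divr_ge0// ltW.
rewrite ln_div ?lnM ?posrE ?subr_gt0//.
by ring.
Qed.

End scores.

(** * The theorem *)

Theorem proposition2 (R : realType) (I : set R)
    (P : probability (measurableTypeR R) R)
    (I_interval : is_interval I) (P_I : P I = 1%E) :
  let G : R -> R := cdfr P in
  [/\ (* (i) *)
      forall mu : {measure set (measurableTypeR R) -> \bar R},
        condG1 G \/ condG2 I G -> atomless01 mu ->
        (forall x y, I x -> I y ->
           GDSd G mu x y =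
           oriented_integral mu (G y) (G x) (fun a => (y < x)%R%:R - a)) /\
        (forall x y x' y', I x -> I y -> I x' -> I y' ->
           G x = G x' -> G y = G y' -> GDSd G mu x y = GDSd G mu x' y'),
      (* (ii) *)
      condG1 G \/ condG2 I G ->
        [/\ forall x y, I x -> I y -> 0 <= S1 G x y <= 1,
            forall mu : {measure set (measurableTypeR R) -> \bar R},
              has_density01 mu (fun=> 2) ->
              forall x y, I x -> I y -> (S1 G x y)%:E = GDSd G mu x y,
            equitable I P (fun x y => (S1 G x y)%:E),
            equivalent_score I (fun x y => (S1 G x y)%:E)
              (fun x y => (LEPSr G x y)%:E)
          & (condG1 G ->
               equitable_const I P (fun x y => (S1 G x y)%:E) (1 / 3)) /\
            (condG2 I G ->
               equitable_const I P (fun x y => (S1 G x y)%:E)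
                 (1 / 3 - G 0 ^+ 2 + 2 * G 0 ^+ 3 / 3))],
      (* (iii) *)
      condG3 G \/ condG4 I G ->
        [/\ forall x y, I x -> I y -> 0 <= S2 G x y,
            forall mu : {measure set (measurableTypeR R) -> \bar R},
              has_density01 mu (fun a => (a * (1 - a))^-1) ->
              forall x y, I x -> I y -> (S2 G x y)%:E = GDSd G mu x y,
            equitable I P (fun x y => (S2 G x y)%:E),
            equivalent_score I (fun x y => (S2 G x y)%:E)
              (fun x y => (GRIN G x y)%:E)
          & (condG3 G ->
               equitable_const I P (fun x y => (S2 G x y)%:E) 1) /\
            (condG4 I G ->
               equitable_const I P (fun x y => (S2 G x y)%:E) (1 - G 0))]
    & (* (iv) *)
      forall u : R -> R,
        measurable_fun (`]0, 1[ : set (measurableTypeR R)) u ->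
        (forall a, 0 < a < 1 -> 0 <= u a) ->
        (exists M : R, forall a, 0 < a < 1 -> `|u a| <= M) ->
        condG1 G \/ condG2 I G ->
        [/\ forall x y, I x -> I y -> 0 <= S3 u G x y,
            forall mu : {measure set (measurableTypeR R) -> \bar R},
              has_density01 mu u ->
              forall x y, I x -> I y -> (S3 u G x y)%:E = GDSd G mu x y,
            equitable I P (fun x y => (S3 u G x y)%:E)
          & (condG1 G ->
               equitable_const I P (fun x y => (S3 u G x y)%:E)
                 (\int[@lebesgue_measure R]_(a in `]0, 1[)
                    (a * (1 - a) * u a))) /\
            (condG2 I G ->
               equitable_const I P (fun x y => (S3 u G x y)%:E)
                 (\int[@lebesgue_measure R]_(a in `]G 0, 1[)
                    (a * (1 - a) * u a)))]].
Proof.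
move=> G.
have regG : condG1 G \/ condG2 I G -> exists b, regular_cdf P I b.
  by case=> [/condG1_regular rG|/condG2_regular rG]; eexists; exact: rG.
have cdf01 := cdfr01 P.
split.
- move=> mu /regG[b rG] amu; split=> [x y Ix Iy|x y x' y' Ix Iy Ix' Iy' exx' eyy'].
    rewrite (GDSd_gap_score rG)// oriented_integral_gap_score ?cdf01//.
      exact: cdfr_lt.
    by move=> /cdfr_lt xy; rewrite -leNgt ltW.
  by rewrite !(GDSd_gap_score rG)// -/G exx' eyy'.
- move=> /regG[b rG].
  have S1E x y : I x -> I y -> (S1 G x y)%:E = gap_score (@lebesgue_measure R) (fun=> 2) (G x) (G y).
    by move=> _ _; exact: S1_gap_score.
  have two0 (a : R) : 0 < a < 1 -> 0 <= 2 :> R by [].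
  have eqS1 b' (rG' : regular_cdf P I b') : equitable_const I P (fun x y => (S1 G x y)%:E)
      (1 / 3 - b' ^+ 2 + 2 * b' ^+ 3 / 3).
    apply: (density_score_equitable I_interval P_I _ two0 S1E rG') => //.
    by apply: integral_brier; exact: regular_le1 rG'.
  split.
  + by move=> x y Ix Iy; rewrite (density_score_ge0 two0 S1E)//= /G S1_le1.
  + move=> mu hmu x y Ix Iy; exact: (density_score_GDSd _ two0 S1E rG).
  + by eexists; exact: eqS1 rG.
  + exists (- 3^-1), (fun y => 2 / 3 + 2 * G y ^+ 2 - 2 * G y); split.
      by rewrite oppr_eq0 invr_eq0.
    by move=> x y _ _; rewrite /G S1_LEPSr.
  + split=> [/(@condG1_regular _ _ I)|/condG2_regular] /eqS1//.
    by rewrite !expr0n/= !(mulr0, mul0r) subr0 addr0.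
- move=> G34.
  have [b [rG G01]] : exists b, regular_cdf P I b /\ forall x, I x -> 0 < G x < 1.
    case: G34 => [[/condG1_regular rG G01]|[cG G1]].
      by exists 0; split=> [|x _]; [exact: rG|exact: G01].
    exists (G 0); split; first exact: condG2_regular.
    move=> x Ix; rewrite G1 andbT.
    have G0 : 0 < G 0 by case: cG => _ [].
    exact: lt_le_trans G0 (regular_support (condG2_regular cG) Ix).
  have S2E x y : I x -> I y -> (S2 G x y)%:E =
      gap_score (@lebesgue_measure R) (fun a => (a * (1 - a))^-1) (G x) (G y).
    by move=> Ix Iy; apply: S2_gap_score; exact: G01.
  have w0 (a : R) : 0 < a < 1 -> 0 <= (a * (1 - a))^-1.
    by move=> /andP[a0 a1]; rewrite invr_ge0 mulr_ge0 ?subr_ge0 ?ltW.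
  have mw := @measurable_log_weight R.
  have eqS2 b' (rG' : regular_cdf P I b') :
      equitable_const I P (fun x y => (S2 G x y)%:E) (1 - b').
    apply: (density_score_equitable I_interval P_I mw w0 S2E rG') => //.
    by apply: integral_log; rewrite (regular_ge0 rG') (regular_le1 rG').
  split.
  + by move=> x y; exact: (density_score_ge0 w0 S2E).
  + by move=> mu hmu x y; exact: (density_score_GDSd mw w0 S2E rG).
  + by eexists; exact: eqS2 rG.
  + exists (- 1), (fun y => - ln (G y) - ln (1 - G y) - 1); split.
      by rewrite oppr_eq0 oner_eq0.
    by move=> x y Ix Iy; rewrite /G S2_GRIN//; exact: G01.
  + split=> [[/(@condG1_regular _ _ I) /eqS2]|[/condG2_regular /eqS2]]//.
    by rewrite subr0.
- move=> u mu01 u0 bu /regG[b rG].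
  have S3E x y : I x -> I y -> (S3 u G x y)%:E =
      gap_score (@lebesgue_measure R) u (G x) (G y).
    by move=> _ _; exact: S3_gap_score.
  have eqS3 b' (rG' : regular_cdf P I b') : equitable_const I P (fun x y => (S3 u G x y)%:E)
      (\int[@lebesgue_measure R]_(a in `]b', 1[) (a * (1 - a) * u a)).
    apply: (density_score_equitable I_interval P_I mu01 u0 S3E rG') => //.
    by apply: integral_weight_fine => //; exact: regular_ge0 rG'.
  split.
  + by move=> x y; exact: (density_score_ge0 u0 S3E).
  + by move=> mu hmu x y; exact: (density_score_GDSd mu01 u0 S3E rG).
  + by eexists; exact: eqS3 rG.
  + by split=> [/(@condG1_regular _ _ I)|/condG2_regular] /eqS3.
Qed.
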